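(* Let $w,\tau,v\in I_{d,n}$ with $w\ge\tau\ge v$. Then the Richardson variety $X_w^v$ is smooth at $e_\tau$ if and only if both $X_w$ and $X^v$ are smooth at $e_\tau$.
   Context: $K$ is an algebraically closed field of arbitrary characteristic, $1\le d<n$, and $G_{d,n}$ is the Grassmannian of $d$-dimensional subspaces of $K^n$. $I_{d,n}=\{(i_1,\dots,i_d)\in\mathbb{N}^d: 1\le i_1<\dots<i_d\le n\}$, partially ordered by $\underline i\ge\underline j\iff i_t\ge j_t$ for all $t$. For $\tau\in I_{d,n}$, $e_\tau\in G_{d,n}$ is the span of $e_{\tau_1},\dots,e_{\tau_d}$. With $V_t=\langle e_1,\dots,e_t\rangle$ and $V^t=\langle e_n,\dots,e_{n-t+1}\rangle$, the Schubert variety is $X_{\underline i}=\{U: \dim(U\cap V_{i_t})\ge t,\ 1\le t\le d\}$, the opposite Schubert variety is $X^{\underline i}=\{U:\dim(U\cap V^{n-i_{(d-t+1)}+1})\ge t,\ 1\le t\le d\}$, and the Richardson variety is $X_w^v=X_w\cap X^v$; it is nonempty iff $w\ge v$, and then reduced and irreducible. One has $e_\tau\in X_w^v\iff w\ge\tau\ge v$. *)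

(* Defs.v *)
From mathcomp Require Import all_boot all_order all_algebra.
From mathcomp Require Import mpoly.

Set Implicit Arguments.
Unset Strict Implicit.
Unset Printing Implicit Defensive.

Import GRing.Theory.
Local Open Scope ring_scope.

(* Subsets of the affine space K^N, given as Prop-valued predicates. *)
Section AffineVarieties.

Variables (K : closedFieldType) (N : nat).
Implicit Types (Y Z : 'rV[K]_N -> Prop) (p u : 'rV[K]_N) (f : {mpoly K[N]}).

Definition subset_of Y Z : Prop := forall u, Y u -> Z u.

Definition vanishes_on Y f : Prop := forall u, Y u -> f.@[u 0] = 0.

Definition zariski_closed Z : Prop :=
  exists P : {mpoly K[N]} -> Prop,
    forall u, Z u <-> (forall f, P f -> f.@[u 0] = 0).

Definition irreducible Z : Prop :=
  (exists u, Z u) /\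
  forall Z1 Z2, zariski_closed Z1 -> zariski_closed Z2 ->
    (forall u, Z u -> Z1 u \/ Z2 u) -> subset_of Z Z1 \/ subset_of Z Z2.

(* A strictly increasing chain C 0, ..., C k of irreducible closed subsets of *)
(* Y through p; such chains correspond to the chains of k + 1 primes in the   *)
(* local ring of Y at p.                                                      *)
Definition chain_at Y p (k : nat) (C : nat -> 'rV[K]_N -> Prop) : Prop :=
  [/\ C 0%N p,
      forall i, (i <= k)%N ->
        [/\ zariski_closed (C i), irreducible (C i) & subset_of (C i) Y] &
      forall i, (i < k)%N ->
        subset_of (C i) (C i.+1) /\ ~ subset_of (C i.+1) (C i)].

Definition local_dim_is Y p (k : nat) : Prop :=
  (exists C, chain_at Y p k C) /\
  forall m, (exists C, chain_at Y p m C) -> (m <= k)%N.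

Definition tangent_vector Y p u : Prop :=
  forall f, vanishes_on Y f -> \sum_(i < N) (f^`M(i)).@[p 0] * u 0 i = 0.

(* The Zariski tangent space at p, for the reduced structure on the closed    *)
(* set Y, has the same dimension as the local ring of Y at p.                 *)
Definition affine_smooth_at Y p : Prop :=
  exists T : {vspace 'rV[K]_N},
    (forall u, u \in T <-> tangent_vector Y p u) /\ local_dim_is Y p (\dim T).

End AffineVarieties.

(* Indices are 0-based: the entry i_t of the d-tuple (i_1 < ... < i_d) with   *)
(* values in {1, ..., n} is (i s).+1, where s : 'I_d has value t - 1.         *)
Record Idn (d n : nat) := MkIdn {
  idn_fun :> 'I_d -> 'I_n;
  idn_incr : forall s t : 'I_d, (s < t)%N -> (idn_fun s < idn_fun t)%N }.

Definition Idn_ge (d n : nat) (i j : Idn d n) : Prop :=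
  forall t : 'I_d, (j t <= i t)%N.

Section Grassmannian.

Variables (K : closedFieldType) (d n : nat).
Implicit Types (U : {vspace 'rV[K]_n}) (X : {vspace 'rV[K]_n} -> Prop).
Implicit Types (i tau w v : Idn d n) (A : 'M[K]_(d, n)).

Definition basis_vec (j : 'I_n) : 'rV[K]_n := delta_mx 0 j.

Definition grassmannian U : Prop := \dim U = d.

Definition e_pt tau : {vspace 'rV[K]_n} :=
  (\sum_(t < d) <[basis_vec (tau t)]>)%VS.

(* <e_1, ..., e_m> *)
Definition flag (m : nat) : {vspace 'rV[K]_n} :=
  (\sum_(j < n | (j < m)%N) <[basis_vec j]>)%VS.

(* <e_n, ..., e_(n-m+1)> *)
Definition opp_flag (m : nat) : {vspace 'rV[K]_n} :=
  (\sum_(j < n | (n - m <= j)%N) <[basis_vec j]>)%VS.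

Definition schubert w U : Prop :=
  grassmannian U /\
  forall t : 'I_d, (t.+1 <= \dim (U :&: flag (w t).+1))%N.

(* rev_ord t is the 0-based position of the 1-based index d - (t + 1) + 1. *)
Definition opp_schubert v U : Prop :=
  grassmannian U /\
  forall t : 'I_d,
    (t.+1 <= \dim (U :&: opp_flag (n - (v (rev_ord t)).+1 + 1)))%N.

Definition richardson w v U : Prop := schubert w U /\ opp_schubert v U.

Definition rowspan A : {vspace 'rV[K]_n} := (\sum_(s < d) <[row s A]>)%VS.

(* Where the Pluecker coordinate p_tau is nonzero, a point of the             *)
(* Grassmannian is the row span of a unique d x n matrix whose columns        *)
(* tau 0, ..., tau (d - 1) form the identity matrix. These matrices form an   *)
(* affine subspace of K^(d * n) of dimension d * (n - d).                     *)
Definition chart_matrix tau A : Prop :=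
  forall s t : 'I_d, A s (tau t) = (s == t)%:R.

Definition in_chart tau X (x : 'rV[K]_(d * n)) : Prop :=
  chart_matrix tau (vec_mx x) /\ X (rowspan (vec_mx x)).

(* For X closed in the Grassmannian, with its reduced structure; smoothness   *)
(* is local, so it does not depend on the chart chosen around U.              *)
Definition smooth_at X U : Prop :=
  exists tau A, [/\ chart_matrix tau A, rowspan A = U &
                    affine_smooth_at (in_chart tau X) (mxvec A)].

End Grassmannian.

Arguments e_pt K {d n} tau.
Arguments schubert K {d n} w U.
Arguments opp_schubert K {d n} v U.
Arguments richardson K {d n} w v U.
Arguments smooth_at {K} d {n} X U.

(* Main.v *)
(* In the affine chart around e_tau the coordinates are the entries (s, j)    *)
(* with j outside tau. Translating by the entries with j < tau_s is the       *)
(* action of a unipotent element of B, so membership of X_w only depends on   *)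
(* the entries with j > tau_s; dually membership of X^v only depends on the   *)
(* entries with j < tau_s. A torus scales the whole chart, so the three       *)
(* varieties are cones with apex e_tau there, and a cone is smooth at its     *)
(* apex iff it is a linear subspace. Linearity of X_w and X^v clearly gives   *)
(* that of the intersection, and conversely each of the two is recovered from *)
(* the intersection by projecting to its half of the coordinates.             *)
(*                                                                            *)
(* That a smooth cone is linear needs that a proper subset of a vector space  *)
(* T carries no chain of dim T + 1 irreducible closed sets. A strict step in  *)
(* such a chain raises the number of algebraically independent functions, and *)
(* counting monomials shows that T has at most dim T of those.                *)

Require Import Defs.
From HB Require Import structures.
From mathcomp Require Import all_boot all_order all_algebra.
From mathcomp Require Import mpoly.
From Stdlib Require Import Classical ProofIrrelevance FunctionalExtensionality.

Set Implicit Arguments.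
Unset Strict Implicit.
Unset Printing Implicit Defensive.

Import GRing.Theory.
Local Open Scope ring_scope.

(** Centred at [e_tau], the chart turns each variety into a cone ([cone_of_scale]), and
    [cone_smooth_at] makes smoothness at the apex equivalent to closure under addition. Unipotent
    translations ([cone_of_shift]) show that [X_w] is a cone in the upper entries times all lower
    entries, and [X^v] the reverse ([cone_schubertE], [cone_opp_schubertE]). The Richardson cone is
    therefore the product of the two partial cones, and a product is linear iff both factors are.
    The dimension theory behind [cone_smooth_at] rests on [alg_indep_step] and [alg_indep_leq]. *)

(** * Algebraic independence and counting of monomials *)

Section AlgebraicIndependence.

Variables (K : closedFieldType) (N : nat).
Implicit Types (fs : nat -> {mpoly K[N]}) (Z : 'rV[K]_N -> Prop).

(** Recursive so that [pow D k.+1] is convertible to [D * pow D k], as [vec_mx] needs in [comb]. *)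
Fixpoint pow (D k : nat) : nat := if k is k'.+1 then (D * pow D k')%N else 1%N.

Lemma powE D k : pow D k = (D ^ k)%N.
Proof. by elim: k => [|k IH] //=; rewrite IH expnS. Qed.

(* The polynomial in [fs 0, ..., fs (k - 1)] with coefficients [c] and all    *)
(* exponents below [D]; the coefficients are flattened so that they form a    *)
(* matrix space whose dimension is visible.                                   *)
Fixpoint comb (D k : nat) fs : 'rV[K]_(pow D k) -> {mpoly K[N]} :=
  if k is k'.+1 then fun c =>
    \sum_(j < D) fs k' ^+ j * comb fs (row j (vec_mx c))
  else fun c => (c 0 0)%:MP.

Definition alg_indep_on Z k fs : Prop :=
  forall D (c : 'rV[K]_(pow D k)), vanishes_on Z (comb fs c) -> c = 0.

Lemma comb_is_linear D k fs : linear (@comb D k fs).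
Proof.
elim: k => [|k IH] a c c' /=.
  by rewrite !mxE mpolyCD mpolyCM mul_mpolyC.
rewrite scaler_sumr -big_split; apply: eq_bigr => j _ /=.
have -> : row j (vec_mx (a *: c + c')) =
    a *: row j (vec_mx c) + row j (vec_mx c').
  by rewrite !linearP.
by rewrite IH mulrDr scalerAr.
Qed.

HB.instance Definition _ D k fs := GRing.isLinear.Build K 'rV[K]_(pow D k)
  {mpoly K[N]} _ (@comb D k fs) (@comb_is_linear D k fs).

Lemma eq_comb D k fs fs' (c : 'rV[K]_(pow D k)) :
  (forall i, (i < k)%N -> fs i = fs' i) -> comb fs c = comb fs' c.
Proof.
elim: k c => [|k IH] //= c E; apply: eq_bigr => j _.
by rewrite E // (IH _ (fun i lt_ik => E i (ltnW lt_ik))).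
Qed.

(** Each of the [k] factors has exponent below [D], and [msize] is degree plus one. The point is
    growth linear in [D]. *)
Lemma msize_comb D k fs e (c : 'rV[K]_(pow D k)) :
  (forall i, (i < k)%N -> (msize (fs i) <= e.+1)%N) ->
  (msize (comb fs c) <= (k * D * e).+1)%N.
Proof.
have mulS (p q : {mpoly K[N]}) a b : (msize p <= a.+1)%N ->
    (msize q <= b.+1)%N -> (msize (p * q) <= (a + b).+1)%N.
  move=> Hp Hq; have [->|p0] := eqVneq p 0; first by rewrite mul0r msize0.
  have [->|q0] := eqVneq q 0; first by rewrite mulr0 msize0.
  rewrite msizeM // -ltnS prednK ?addn_gt0 ?lt0n ?msize_poly_eq0 ?p0 //.
  by rewrite -addSn -addnS leq_add.
elim: k c => [|k IH] c He /=; first by rewrite msizeC; case: eqP.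
apply: leq_trans (msize_sum _ _ _) _; apply/bigmax_leqP => j _.
have Hj : (msize (fs k ^+ j) <= (j * e).+1)%N.
  elim: {c}(j : nat) => [|i IHi]; first by rewrite expr0 msize1.
  by rewrite exprS mulSn; apply: mulS => //; apply: He.
apply: leq_trans (mulS _ _ _ _ Hj (IH _ (fun i lt_ik => He i (ltnW lt_ik)))) _.
by rewrite ltnS mulSn mulnDl leq_add2r leq_mul2r ltnW ?orbT.
Qed.

(** Turns vanishing into [E ^ N] linear conditions. *)
Lemma mpoly_eq0_coef E (f : {mpoly K[N]}) : (msize f <= E)%N ->
  (forall a : {ffun 'I_N -> 'I_E}, f@_[multinom (a i : nat) | i < N] = 0) ->
  f = 0.
Proof.
move=> sf f0; apply/mpolyP => m; rewrite mcoeff0.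
have [m_f|/memN_msupp_eq0 //] := boolP (m \in msupp f).
have lt_mE i : (m i < E)%N.
  apply: leq_ltn_trans (leq_trans (msize_mdeg_lt m_f) sf).
  by rewrite mdegE (bigD1 i) //= leq_addr.
rewrite -(f0 [ffun i => Ordinal (lt_mE i)]); congr (_ @__).
by apply/mnmP => i; rewrite mnmE ffunE.
Qed.

(* Counting: [D ^ k] monomials in the [fs i] against at most [E ^ N]          *)
(* monomials in the variables, where [E] grows linearly with [D].             *)
Lemma alg_indep_leq k fs :
  (forall D (c : 'rV[K]_(pow D k)), comb fs c = 0 -> c = 0) -> (k <= N)%N.
Proof.
move=> indep; rewrite leqNgt; apply/negP => lt_Nk.
pose e := \max_(i < k) msize (fs i).
have He i : (i < k)%N -> (msize (fs i) <= e.+1)%N.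
  by move=> ik; rewrite leqW // (leq_bigmax (Ordinal ik)).
(* Since [E <= D * (k * e).+1], taking [D > (k * e).+1 ^ N] gives [E ^ N < D ^ N.+1 <= D ^ k]. *)
pose D := ((k * e).+1 ^ N).+1; pose E := (k * D * e).+1.
pose M : 'M[K]_(pow D k, #|{ffun 'I_N -> 'I_E}|) :=
  \matrix_(r, j) (comb fs (delta_mx 0 r))@_[
    multinom ((enum_val j : {ffun 'I_N -> 'I_E}) i : nat) | i < N].
have combE (c : 'rV[K]_(pow D k)) :
    comb fs c = \sum_r c 0 r *: comb fs (delta_mx 0 r).
  rewrite {1}[c]row_sum_delta linear_sum.
  by apply: eq_bigr => r _; rewrite linearZ.
have inj (c : 'rV_(pow D k)) : c *m M = 0 -> c = 0.
  move=> cM; apply: indep; apply: mpoly_eq0_coef (msize_comb c He) _ => a.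
  have /rowP/(_ (enum_rank a)) := cM; rewrite !mxE => <-.
  rewrite combE raddf_sum /=; apply: eq_bigr => r _.
  by rewrite mcoeffZ mxE enum_rankK.
have ker0 : kermx M = 0.
  by apply/row_matrixP => r; rewrite row0; apply: inj;
    rewrite -row_mul mulmx_ker row0.
have : (\rank M <= #|{ffun 'I_N -> 'I_E}|)%N by apply: rank_leq_col.
have := mxrank_ker M; rewrite ker0 mxrank0 => /esym/eqP; rewrite subn_eq0.
move=> /leq_trans/[apply]; rewrite powE card_ffun !card_ord leqNgt => /negP;
  apply.
have leE : (E <= D * (k * e).+1)%N.
  by rewrite /E mulnS -add1n leq_add // mulnA (mulnC D).
have leX n : (E ^ n <= D ^ n * (k * e).+1 ^ n)%N.
  by rewrite -expnMn; case: n => // n; rewrite leq_exp2r.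
apply: leq_ltn_trans (leX N) _.
apply: (@leq_trans (D ^ N.+1)); last by rewrite leq_pexp2l.
by rewrite expnSr ltn_pmul2l ?expn_gt0.
Qed.

End AlgebraicIndependence.

(** * Chains of irreducible closed sets, and smoothness of cones *)

Section KrullDimension.

Variables (K : closedFieldType) (N : nat).
Implicit Types (f g : {mpoly K[N]}) (fs : nat -> {mpoly K[N]}).
Implicit Types (Y Z : 'rV[K]_N -> Prop) (p u x : 'rV[K]_N).
Implicit Types (T : {vspace 'rV[K]_N}).

(** Cover [Z] by the zero loci of the two factors. *)
Lemma irreducible_prime Z f g : irreducible Z -> vanishes_on Z (f * g) ->
  vanishes_on Z f \/ vanishes_on Z g.
Proof.
have closedV h : zariski_closed (fun u : 'rV[K]_N => h.@[u 0] = 0).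
  by exists (eq h) => u; split=> [hu _ <-|]; last exact.
move=> [_ irrZ] fg0; apply: irrZ => // u /fg0; rewrite mevalM => /eqP.
by rewrite mulf_eq0 => /orP[] /eqP; [left | right].
Qed.

Lemma closed_separation Z Z' : zariski_closed Z -> ~ subset_of Z' Z ->
  exists f u, [/\ vanishes_on Z f, Z' u & f.@[u 0] != 0].
Proof.
move=> [P PZ] nsub; apply: NNPP => nex; apply: nsub => u Z'u; apply/PZ => f Pf.
apply: NNPP => /eqP fu; apply: nex; exists f, u; split=> // z /PZ; exact.
Qed.

Lemma alg_indep_sub Z Z' k fs :
  subset_of Z Z' -> alg_indep_on Z k fs -> alg_indep_on Z' k fs.
Proof. by move=> sub indep D c c0; apply: indep => u /sub/c0. Qed.

(* A function vanishing on [Z] but not on [Z'] is independent from functions  *)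
(* that are already independent on [Z]: in a relation over [Z'], divide by    *)
(* the largest power of it and restrict to [Z].                               *)
Lemma alg_indep_step Z Z' k fs : subset_of Z Z' -> ~ subset_of Z' Z ->
    zariski_closed Z -> irreducible Z' -> alg_indep_on Z k fs ->
  exists fs', alg_indep_on Z' k.+1 fs'.
Proof.
move=> sub nsub clZ irrZ' indep.
have [f [x [f0 Z'x /eqP fx]]] := closed_separation clZ nsub.
have nf0 : ~ vanishes_on Z' f by move/(_ x Z'x).
(* Slot [k] is the outermost variable of [comb], so a relation becomes a polynomial in [f] over the
   old functions. *)
pose fs' i := if i == k then f else fs i;
  have fs'k : fs' k = f by rewrite /fs' eqxx.
exists fs' => D c /=; rewrite fs'k => c0.
have Efs (c' : 'rV_(pow D k)) : comb fs' c' = comb fs c'.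
  by apply: eq_comb => i ik; rewrite /fs' ltn_eqF.
suff rows0 (j : 'I_D) : row j (vec_mx c) = 0.
  rewrite -[c]vec_mxK (_ : vec_mx c = 0) ?linear0 //.
  by apply/row_matrixP => j; rewrite rows0 row0.
have [i] := ubnP (j : nat); elim: i j => // i IH j; rewrite ltnS => le_ji.
(* Rows before [j] vanish by induction, so [h] is the relation divided by [f ^+ j]; on [Z] only its
   term [l = j] survives. *)
pose h := \sum_(l < D | (j <= l)%N) f ^+ (l - j) * comb fs (row l (vec_mx c)).
have fh : f ^+ j * h = \sum_(l < D) f ^+ l * comb fs' (row l (vec_mx c)).
  rewrite [RHS](bigID (fun l : 'I_D => (j <= l)%N)) /= [X in _ + X]big1.
    rewrite addr0 mulr_sumr; apply: eq_bigr => l jl.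
    by rewrite mulrA -exprD subnKC // Efs.
  by move=> l; rewrite -ltnNge => lj;
    rewrite IH ?(leq_trans lj) // linear0 mulr0.
have fXh l : vanishes_on Z' (f ^+ l * h) -> vanishes_on Z' h.
  elim: l => [|l IHl]; first by rewrite expr0 mul1r.
  by rewrite exprS -mulrA => /(irreducible_prime irrZ')[/nf0|].
have h0 : vanishes_on Z' h by apply: (fXh j); rewrite fh.
apply: indep => u Zu; rewrite -(h0 u (sub u Zu)) /h (bigD1 j) //= subnn mul1r.
rewrite mevalD raddf_sum /= big1 ?addr0 // => l /andP[jl nlj].
rewrite mevalM rmorphXn /= f0 // expr0n subn_eq0 leqNgt ltn_neqAle jl andbT.
by rewrite eq_sym nlj mul0r.
Qed.

(** Nonzero constants do not vanish on the nonempty [C 0]; each strict inclusion then contributes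
    one function. *)
Lemma chain_alg_indep k (C : nat -> 'rV[K]_N -> Prop) :
    (forall i, (i <= k)%N -> zariski_closed (C i) /\ irreducible (C i)) ->
    (forall i, (i < k)%N ->
       subset_of (C i) (C i.+1) /\ ~ subset_of (C i.+1) (C i)) ->
  exists fs, alg_indep_on (C k) k fs.
Proof.
elim: k => [|k IH] irrC incC.
  exists (fun=> 0) => D c c0; have [_ [[u Cu] _]] := irrC 0%N isT.
  by apply/rowP => i; rewrite ord1 mxE; have := c0 u Cu; rewrite /= mevalC.
have [fs indep] := IH (fun i ik => irrC i (leqW ik))
  (fun i ik => incC i (leqW ik)).
have [sub nsub] := incC k (ltnSn k).
by apply: (alg_indep_step sub nsub _ _ indep); apply irrC.
Qed.

Definition affine_space p T u : Prop := u - p \in T.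

Lemma comb_comp m (lq : N.-tuple {mpoly K[m]}) D k fs (c : 'rV[K]_(pow D k)) :
  comb (fun i => fs i \mPo lq) c = comb fs c \mPo lq.
Proof.
elim: k c => [|k IH] c /=; first by rewrite comp_mpolyC.
rewrite raddf_sum /=; apply: eq_bigr => j _.
by rewrite IH rmorphM rmorphXn.
Qed.

(** A basis of [T] parametrises the space, and substitution leaves polynomials in [\dim T]
    variables, to which [alg_indep_leq] applies. *)
Lemma affine_alg_indep p T k fs :
  alg_indep_on (affine_space p T) k fs -> (k <= \dim T)%N.
Proof.
move=> indep; pose b := vbasis T.
pose lq : N.-tuple {mpoly K[\dim T]} :=
  [tuple (p 0 i)%:MP + \sum_(j < \dim T) (b`_j 0 i) *: 'X_j | i < N].
apply: (@alg_indep_leq _ _ _ (fun i => fs i \mPo lq)) => D c.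
rewrite comb_comp => c0; apply: indep => u uT.
have := congr1 (meval (fun j => coord b j (u - p))) c0.
rewrite meval0 comp_mpoly_meval => <-; apply: meval_eq => i.
rewrite tnth_mktuple mevalD mevalC raddf_sum /=.
rewrite -[u in LHS](subrK p) addrC mxE; congr (_ + _).
rewrite {1}(coord_vbasis uT) summxE; apply: eq_bigr => j _.
by rewrite mxE mevalZ mevalXU mulrC.
Qed.

(** The restriction of [f] to the line through [p] with direction [u]. *)
Definition line_poly p u f : {poly K} :=
  mmap (@polyC K) (fun i => (p 0 i)%:P + (u 0 i) *: 'X) f.

Lemma line_polyE p u f t : (line_poly p u f).[t] = f.@[(p + t *: u) 0].
Proof.
rewrite /line_poly /meval /mmap horner_sum; apply: eq_bigr => m _.
rewrite hornerM hornerC horner_prod; congr (_ * _); apply: eq_bigr => i _.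
by rewrite horner_exp hornerD hornerC hornerZ hornerX !mxE mulrC.
Qed.

Lemma poly_fun_eq0 (q : {poly K}) : (forall t, q.[t] = 0) -> q = 0.
Proof.
move=> q0; apply/eqP/negPn/negP => /closed_nonrootP[t].
by rewrite /root q0 eqxx.
Qed.

Lemma mderivXU (i j : 'I_N) : 'X_j^`M(i) = (j == i)%:R :> {mpoly K[N]}.
Proof.
rewrite mderivX mnm1E; case: eqP => [->|_]; last by rewrite scale0r.
by rewrite scale1r -mpolyX0; congr 'X_[_]; apply/mnmP => k;
  rewrite mnmBE subnn mnm0E.
Qed.

(** Both sides are additive and obey the Leibniz rule, so constants and variables suffice. *)
Lemma deriv_line_poly p u f :
  (line_poly p u f)^`().[0] = \sum_(i < N) (f^`M(i)).@[p 0] * u 0 i.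
Proof.
have at0 g : (line_poly p u g).[0] = g.@[p 0].
  by rewrite line_polyE scale0r addr0.
pose P g := (line_poly p u g)^`().[0] = \sum_(i < N) (g^`M(i)).@[p 0] * u 0 i.
have PC c : P c%:MP.
  rewrite /P /line_poly mmapC derivC horner0 big1 // => i _.
  by rewrite mderivC meval0 mul0r.
have PM g h : P g -> P h -> P (g * h).
  rewrite /P => Pg Ph; rewrite /line_poly rmorphM /= derivM hornerD !hornerM.
  rewrite -!/(line_poly _ _ _) !at0 Pg Ph mulr_suml mulr_sumr -big_split /=.
  apply: eq_bigr => i _; rewrite mderivM mevalD !mevalM mulrDl.
  by rewrite mulrAC !mulrA.
have PX i : P 'X_i.
  rewrite /P /line_poly mmapX mmap1U derivD derivC derivZ derivX add0r.
  rewrite hornerZ hornerC mulr1 (bigD1 i) //= mderivXU eqxx meval1 mul1r big1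
    ?addr0 // => j ji.
  by rewrite mderivXU eq_sym (negPf ji) meval0 mul0r.
elim/mpolyind: f => [|c m f _ _ Pf]; first by rewrite -mpolyC0; apply: PC.
have Pm : P 'X_[m].
  rewrite mpolyXE_id; apply: (big_ind P) => [||i _];
    [by rewrite -mpolyC1| exact: PM|].
  by elim: (m i) => [|k IH]; rewrite ?expr0 -?mpolyC1 // exprS; apply: PM.
have : P (c *: 'X_[m]) by rewrite -mul_mpolyC; apply: PM.
rewrite /P => Pcm; rewrite /line_poly rmorphD /= derivD hornerD.
rewrite -!/(line_poly _ _ _) Pcm Pf -big_split; apply: eq_bigr => i _.
by rewrite mderivD mevalD mulrDl.
Qed.

(** Otherwise the line joining a witness against each closed set would carry two nonzero
    one-variable polynomials with product zero. *)
Lemma affine_space_irreducible p T : irreducible (affine_space p T).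
Proof.
split; first by exists p; rewrite /affine_space subrr mem0v.
move=> Z1 Z2 cl1 cl2 cov; apply: NNPP => /not_or_and[n1 n2].
have [f [x [f0 Tx fx]]] := closed_separation cl1 n1.
have [g [y [g0 Ty gy]]] := closed_separation cl2 n2.
suff /eqP : line_poly x (y - x) f * line_poly x (y - x) g = 0.
  rewrite mulf_eq0 => /orP[] /eqP E.
    by have := line_polyE x (y - x) f 0;
      rewrite E horner0 scale0r addr0 => /esym/eqP/idPn[].
  by have := line_polyE x (y - x) g 1;
    rewrite E horner0 scale1r subrKC => /esym/eqP/idPn[].
apply: poly_fun_eq0 => t; rewrite hornerM !line_polyE.
have /cov[/f0->|/g0->] : affine_space p T (x + t *: (y - x));
  rewrite ?mul0r ?mulr0 //.
rewrite /affine_space addrAC rpredD // rpredZ //.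
have -> : y - x = (y - p) - (x - p) by rewrite opprB subrKA.
by rewrite rpredB.
Qed.

(** The form is a coordinate of [y - projv T y] that is nonzero at [x]. *)
Lemma linear_form_separation T x : x \notin T -> exists a : 'I_N -> K,
  (forall y, y \in T -> \sum_i a i * y 0 i = 0) /\ \sum_i a i * x 0 i != 0.
Proof.
move=> xT; have /rV0Pn[j xj] : x - projv T x != 0.
  by apply: contraNneq xT => /subr0_eq->; apply: memv_proj.
pose a (i : 'I_N) : K := (delta_mx 0 i - projv T (delta_mx 0 i)) 0 j.
have aE (y : 'rV[K]_N) : \sum_i a i * y 0 i = (y - projv T y) 0 j.
  rewrite [in RHS](row_sum_delta y) linear_sum -sumrB summxE.
  by apply: eq_bigr => i _; rewrite linearZ -scalerBr mxE mulrC.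
exists a; split=> [y yT|]; last by rewrite aE.
by rewrite aE projv_id // subrr mxE.
Qed.

Definition affine_form p (a : 'I_N -> K) : {mpoly K[N]} :=
  \sum_i a i *: ('X_i - (p 0 i)%:MP).

Lemma affine_formE p a u : (affine_form p a).@[u 0] = \sum_i a i * (u - p) 0 i.
Proof.
rewrite raddf_sum; apply: eq_bigr => i _ /=.
by rewrite mevalZ mevalB mevalXU mevalC !mxE.
Qed.

Lemma mderiv_affine_form p a i : (affine_form p a)^`M(i) = (a i)%:MP.
Proof.
rewrite /affine_form linear_sum (bigD1 i) //= mderivZ mderivB mderivC subr0.
rewrite mderivXU eqxx big1 ?addr0 => [|j ji].
  by rewrite -mul_mpolyC mulr1.
by rewrite mderivZ mderivB mderivC mderivXU (negPf ji) subr0 scaler0.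
Qed.

Lemma affine_space_closed p T : zariski_closed (affine_space p T).
Proof.
exists (vanishes_on (affine_space p T)) => u; split=> [Tu f|u0]; first exact.
apply: NNPP => /negP/linear_form_separation[a [aT au]].
case/negP: au; rewrite -affine_formE; apply/eqP/u0 => y /aT.
by rewrite affine_formE.
Qed.

(** Since [V] is only a [Prop], a subspace inside it is enlarged by missing vectors, chosen
    classically, until none is left; [k] bounds the codimension. *)
Lemma linear_pred_vspace (V : 'rV[K]_N -> Prop) : V 0 ->
    (forall x y, V x -> V y -> V (x + y)) -> (forall c x, V x -> V (c *: x)) ->
  exists T, forall u, u \in T <-> V u.
Proof.
move=> V0 VD VZ.
suff grow k T : (\dim {:'rV[K]_N} - \dim T < k)%N ->
    (forall u, u \in T -> V u) ->
    exists T, forall u, u \in T <-> V u.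
  by apply: (grow _ 0%VS (ltnSn _)) => u; rewrite memv0 => /eqP->.
elim: k T => // k IH T; rewrite ltnS => leT subT.
have [[u Vu uT]|nu] := classic (exists2 u, V u & u \notin T); last first.
  exists T => u; split=> [/subT //|Vu]; apply: contraT => uT.
  by case: nu; exists u.
apply: (IH (T + <[u]>)%VS) => [|x /memv_addP[y /subT Vy [z /vlineP[c ->] ->]]];
  last first.
  exact: VD (VZ _ _ Vu).
have ltT : (\dim T < \dim (T + <[u]>))%N.
  rewrite (ltn_leqif (dimv_leqif_eq (addvSl _ _))); apply: contra uT => /eqP->.
  by rewrite memvE addvSr.
apply: leq_trans leT; apply: ltn_sub2l => //.
exact: leq_trans ltT (dimvS (subvf _)).
Qed.

(* A cone lies in its tangent space [T] at the apex, and a proper subset of   *)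
(* [T] has smaller Krull dimension; hence smooth cones are linear.            *)
Lemma cone_smooth_at Y p : Y p -> (forall c x, Y (p + x) -> Y (p + c *: x)) ->
  affine_smooth_at Y p <->
  (forall x y, Y (p + x) -> Y (p + y) -> Y (p + (x + y))).
Proof.
move=> Yp YZ; have tangY x : Y (p + x) -> tangent_vector Y p x.
  move=> Yx f f0; rewrite -deriv_line_poly (_ : line_poly p x f = 0) ?linear0
    ?horner0 //.
  by apply: poly_fun_eq0 => t; rewrite line_polyE f0 //; apply: YZ.
split=> [[T [TE [[C [_ C1 C2]] _]]] x y Yx Yy|YD].
  (* The top of the chain misses [p + (x + y)], so it is proper in [p + T]; one more step yields
     [\dim T + 1] independent functions there. *)
  apply: NNPP => nYxy.
  have [fs indep] : exists fs, alg_indep_on (C (\dim T)) (\dim T) fs.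
    by apply: chain_alg_indep C2 => i /C1[].
  have [clC _ subC] := C1 _ (leqnn _).
  have subT : subset_of (C (\dim T)) (affine_space p T).
    by move=> u /subC Yu; apply/TE/tangY; rewrite subrKC.
  have nsub : ~ subset_of (affine_space p T) (C (\dim T)).
    move=> /(_ (p + (x + y)))/[dup] H _; apply/nYxy/subC/H.
    by rewrite /affine_space addrC addKr rpredD //; apply/TE/tangY.
  have [fs' /affine_alg_indep] :=
    alg_indep_step subT nsub clC (affine_space_irreducible p T) indep.
  by rewrite ltnn.
have [|T TE] := @linear_pred_vspace (fun x => Y (p + x)) _ YD YZ;
  first by rewrite addr0.
have YE u : Y u <-> affine_space p T u.
  by rewrite -{1}(subrKC p u); split=> /TE.
exists T; split=> [u|].
  split=> [/TE/tangY //|tu];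
    apply: NNPP => /negP/linear_form_separation[a [aT]].
  (* If [u] is not in [T], this form vanishes on [Y] but has nonzero derivative along [u]. *)
  have /tu : vanishes_on Y (affine_form p a) by move=> y /YE/aT;
    rewrite affine_formE.
  rewrite (eq_bigr (fun i => a i * u 0 i)) => [->|i _]; first by rewrite eqxx.
  by rewrite mderiv_affine_form mevalC.
split=> [|m [C [_ C1 C2]]]; last first.
  have [fs indep] : exists fs, alg_indep_on (C m) m fs.
    by apply: chain_alg_indep C2 => i /C1[].
  apply: (@affine_alg_indep p _ _ fs); apply: alg_indep_sub indep => u.
  by have [_ _ subC] := C1 _ (leqnn m); move/subC/YE.
(* A full flag of [T], translated to [p], is a chain of length [\dim T]. *)
pose S i := <<take i (vbasis T)>>%VS.
have dimS i : (i <= \dim T)%N -> \dim (S i) = i.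
  move=> iT; have /eqP-> : free (take i (vbasis T)).
    by apply: (@catl_free _ _ (drop i (vbasis T)));
      rewrite cat_take_drop (basis_free (vbasisP T)).
  by rewrite size_take size_tuple; case: ltngtP iT.
have subS i j : (i <= j)%N -> (S i <= S j)%VS.
  by move=> ij; apply: sub_span => x; rewrite -(subnKC ij) takeD mem_cat => ->.
exists (fun i => affine_space p (S i)); split=> [|i iT|i iT].
- by rewrite /affine_space subrr mem0v.
- split; [exact: affine_space_closed | exact: affine_space_irreducible|].
  move=> u Su; apply/YE; apply: subvP Su; apply/span_subvP => x /mem_take.
  exact: vbasis_mem.
- split=> [u|sub]; first exact/subvP/subS.
  have /dimvS : (S i.+1 <= S i)%VS.
    apply/subvP => x Sx; have := sub (p + x).
    by rewrite /affine_space addrC addKr; apply.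
  by rewrite !dimS ?ltnn // ltnW.
Qed.

End KrullDimension.

(** * Increasing tuples *)

Section IndexTuples.

Variables (d n : nat).
Implicit Types (i tau : Idn d n).

Lemma Idn_eqP i tau : i =1 tau -> i = tau.
Proof.
case: i tau => [f fP] [g gP] /= E.
have {}E : f = g by apply: functional_extensionality.
by case: g / E gP => gP; congr MkIdn; apply: proof_irrelevance.
Qed.

Lemma Idn_mono tau s t : (tau s < tau t)%N = (s < t)%N.
Proof.
case: (ltngtP s t) => [/idn_incr-> //|/(idn_incr tau) ts|/val_inj->];
  last exact: ltnn.
by rewrite ltnNge ltnW.
Qed.

Lemma Idn_leq tau s t : (tau s <= tau t)%N = (s <= t)%N.
Proof. by rewrite leqNgt Idn_mono -leqNgt. Qed.

Lemma Idn_inj tau : injective tau.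
Proof.
by move=> s t E; apply/val_inj/eqP; rewrite eqn_leq -!(Idn_leq tau) E leqnn.
Qed.

(** [i] factors through [tau] by a strictly increasing self-map [h] of ['I_d]. Comparing with the
    first and last index forces [h s = s]. *)
Lemma Idn_sub_image i tau : (forall s, exists t, i s = tau t) -> i = tau.
Proof.
move=> sub; apply: Idn_eqP => s.
have [h hE] : exists h : 'I_d -> 'I_d, forall s, i s = tau (h s).
  exact: (fin_all_exists sub).
have shift k (s1 s2 : 'I_d) : (s1 + k <= s2)%N -> (h s1 + k <= h s2)%N.
  elim: k s2 => [|k IH] s2.
    by rewrite !addn0 -(Idn_leq i) !hE Idn_leq.
  rewrite !addnS => lt_s2; have lt_d := ltn_trans lt_s2 (ltn_ord s2).
  apply: leq_ltn_trans (IH (Ordinal lt_d) (leqnn _)) _.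
  by rewrite -(Idn_mono tau) -!hE Idn_mono.
have d_gt0 : (0 < d)%N := leq_ltn_trans (leq0n s) (ltn_ord s).
have lt_d : (d.-1 < d)%N by rewrite prednK.
have le_sd : (s <= d.-1)%N by rewrite -ltnS prednK.
rewrite hE; congr (tau _); apply/val_inj/eqP; rewrite eqn_leq; apply/andP;
  split.
  have := shift (d.-1 - s)%N s (Ordinal lt_d);
    rewrite /= subnKC // => /(_ (leqnn _)).
  move=> /leq_trans/(_ (_ : (_ <= s + (d.-1 - s))%N)); rewrite leq_add2r; apply.
  by rewrite subnKC // -ltnS prednK.
have := shift s (Ordinal d_gt0) s; rewrite /= add0n => /(_ (leqnn _)).
by apply: leq_trans; apply: leq_addl.
Qed.

End IndexTuples.

(** * Coordinate subspaces and dimension bounds *)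

Section CoordinateSubspaces.

Variables (K : closedFieldType) (n : nat).
Implicit Types (Q : pred 'I_n) (x : 'rV[K]_n) (U W : {vspace 'rV[K]_n}).

Definition coord_space Q : {vspace 'rV[K]_n} :=
  (\sum_(j < n | Q j) <[basis_vec K j]>)%VS.

Lemma coord_spaceP Q x :
  reflect (forall j, ~~ Q j -> x 0 j = 0) (x \in coord_space Q).
Proof.
apply: (iffP idP) => [/memv_sumP[u uE ->] j Qj | x0].
  rewrite summxE big1 // => i Qi; have /vlineP[c ->] := uE i Qi.
  by rewrite !mxE eqxx /=; case: eqP Qj => [->|]; rewrite ?Qi ?mulr0.
rewrite [x]row_sum_delta (bigID Q) /= [X in _ + X]big1 ?addr0 => [|j /x0->];
  last first.
  by rewrite scale0r.
by apply: memv_sumr => j _; rewrite memvZ // memv_line.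
Qed.

Lemma mem_basis_vec Q j : (basis_vec K j \in coord_space Q) = Q j.
Proof.
apply/coord_spaceP/idP => [x0|Qj l nQl].
  by apply: contraT => /x0/eqP; rewrite mxE !eqxx oner_eq0.
by rewrite mxE eqxx /=; case: eqP nQl => // ->; rewrite Qj.
Qed.

Lemma leq_dim_basis_vec k (h : 'I_k -> 'I_n) W : injective h ->
  (forall i, basis_vec K (h i) \in W) -> (k <= \dim W)%N.
Proof.
move=> h_inj hW; pose M : 'M[K]_(k, n) := \matrix_i basis_vec K (h i).
pose phi : 'Hom('rV[K]_k, 'rV[K]_n) := linfun (mulmxr M).
have MM : M *m M^T = 1%:M.
  apply/matrixP => i j; rewrite !mxE (bigD1 (h i)) //= !mxE !eqxx mul1r.
  rewrite big1 ?addr0 => [|l li]; last by rewrite !mxE eqxx (negPf li) mul0r.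
  by rewrite (inj_eq h_inj).
have ker0 : lker phi == 0%VS.
  apply/lker0P => x y; rewrite !lfunE /= => /(congr1 (mulmxr M^T)) /=.
  by rewrite -!mulmxA MM !mulmx1.
have <- : \dim (phi @: fullv) = k.
  by rewrite limg_dim_eq ?(eqP ker0) ?capv0 // dimvf /dim /= mul1n.
apply/dimvS/subvP => _ /memv_imgP[x _ ->]; rewrite lfunE /= mulmx_sum_row.
by apply: memv_suml => i _; rewrite memvZ // rowK.
Qed.

Lemma leq_dim_capv_mulmx (g : 'M[K]_n) U W : g \in unitmx ->
    (forall x, x \in W -> x *m g \in W) ->
  (\dim (U :&: W) <= \dim (linfun (mulmxr g) @: U :&: W))%N.
Proof.
move=> g_unit gW; pose phi : 'End('rV[K]_n) := linfun (mulmxr g).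
have ker0 : lker phi == 0%VS.
  by apply/lker0P => x y; rewrite !lfunE /= => /(can_inj (mulmxK g_unit)).
rewrite -(@limg_dim_eq _ _ _ phi (U :&: W)) ?(eqP ker0) ?capv0 //.
apply/dimvS/subvP => _ /memv_imgP[x /memv_capP[xU xW] ->].
by rewrite memv_cap memv_img // lfunE gW.
Qed.

End CoordinateSubspaces.

(** * The chart at [e_tau] and the group elements acting on it *)

Section Chart.

Variables (K : closedFieldType) (d n : nat) (tau : Idn d n).
Implicit Types (A B C : 'M[K]_(d, n)) (Q : 'I_d -> pred 'I_n).

Definition centre : 'M[K]_(d, n) := \matrix_(s, j) (j == tau s)%:R.

(** Displacements within the chart: the columns in [tau] are fixed. *)
Definition tangent B : Prop := forall s t : 'I_d, B s (tau t) = 0.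

Lemma row_centre s : row s centre = basis_vec K (tau s).
Proof. by apply/rowP => j; rewrite !mxE eqxx. Qed.

Lemma rowspan_centre : rowspan centre = e_pt K tau.
Proof. by apply: eq_bigr => s _; rewrite row_centre. Qed.

Lemma chart_matrixE B : chart_matrix tau (centre + B) <-> tangent B.
Proof.
have E s t : (centre + B) s (tau t) = (s == t)%:R + B s (tau t).
  by rewrite !mxE (inj_eq (@Idn_inj _ _ tau)) eq_sym.
split=> H s t; last by rewrite E H addr0.
by apply: (addrI (s == t)%:R); rewrite -E H addr0.
Qed.

Lemma mul_tr_centre m (B : 'M[K]_(m, n)) s t :
  (B *m centre^T) s t = B s (tau t).
Proof.
rewrite mxE (bigD1 (tau t)) //= !mxE eqxx mulr1 big1 ?addr0 // => j jt.
by rewrite !mxE (negPf jt) mulr0.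
Qed.

Lemma tangentE B : tangent B <-> B *m centre^T = 0.
Proof.
split=> [TB|B0 s t]; last by rewrite -mul_tr_centre B0 mxE.
by apply/matrixP => s t; rewrite mul_tr_centre TB mxE.
Qed.

Lemma centreK : centre *m centre^T = 1%:M.
Proof.
apply/matrixP => s t; rewrite mul_tr_centre !mxE (inj_eq (@Idn_inj _ _ tau)).
by rewrite eq_sym.
Qed.

(** [smooth_at] ranges over all charts; this leaves only one. Rows of [A] are supported on the
    columns in [tau], while [A s (i s) = 1], so every [i s] occurs in [tau]. *)
Lemma chart_e_pt (i : Idn d n) A :
  chart_matrix i A -> rowspan A = e_pt K tau -> i = tau /\ A = centre.
Proof.
move=> chA spA.
have A0 s j : (forall t, tau t != j) -> A s j = 0.
  move=> jt; have : row s A \in e_pt K tau.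
    by rewrite -spA (subvP (sumv_sup s _ (subvv _))) ?memv_line.
  move=> /memv_sumP[u uE /rowP/(_ j)]; rewrite mxE => ->.
  rewrite summxE big1 // => t _; have /vlineP[c ->] := uE t isT.
  by rewrite !mxE eqxx eq_sym (negPf (jt t)) mulr0.
have E : i = tau.
  apply: Idn_sub_image => s;
    have [/existsP[t /eqP <-]|] := boolP [exists t, tau t == i s].
    by exists t.
  rewrite negb_exists => /forallP/(A0 s)/eqP; rewrite chA eqxx oner_eq0 //.
split=> //; apply/matrixP => s j; rewrite mxE.
have [/existsP[t /eqP <-]|] := boolP [exists t, tau t == j].
  by rewrite -E chA (inj_eq (@Idn_inj _ _ i)) eq_sym.
rewrite negb_exists => /forallP jt; rewrite A0 // eq_sym.
by rewrite (negPf (jt s)).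
Qed.

Lemma smooth_at_e_pt X : smooth_at d X (e_pt K tau) <->
  affine_smooth_at (in_chart tau X) (mxvec centre).
Proof.
split=> [[i [A [chA spA smA]]]|smX].
  by have [Ei EA] := chart_e_pt chA spA; rewrite Ei EA in smA.
exists tau, centre; split=> //; last exact: rowspan_centre.
by rewrite -[centre]addr0; apply/chart_matrixE => s t; rewrite mxE.
Qed.

(* [schubert w] and [opp_schubert v] are convertible to instances of this,    *)
(* see [below] and [above].                                                   *)
Definition incident Q (U : {vspace 'rV[K]_n}) : Prop :=
  \dim U = d /\ forall t : 'I_d, (t.+1 <= \dim (U :&: coord_space K (Q t)))%N.

Lemma rowspan_mulmx A (g : 'M[K]_n) :
  rowspan (A *m g) = (linfun (mulmxr g) @: rowspan A)%VS.
Proof.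
rewrite /rowspan limg_sum; apply: eq_bigr => s _.
by rewrite limg_line lfunE /= row_mul.
Qed.

Lemma incident_mulmx Q A (g : 'M[K]_n) : g \in unitmx ->
    (forall t x, x \in coord_space K (Q t) -> x *m g \in coord_space K (Q t)) ->
  incident Q (rowspan A) -> incident Q (rowspan (A *m g)).
Proof.
move=> g_unit gQ [dimA incA]; rewrite rowspan_mulmx; split=> [|t]; last first.
  exact: leq_trans (incA t) (leq_dim_capv_mulmx _ g_unit (gQ t)).
rewrite limg_dim_eq // (_ : lker _ = 0%VS) ?capv0 //; apply/eqP/lker0P => x y.
by rewrite !lfunE /= => /(can_inj (mulmxK g_unit)).
Qed.

(** [X] in the chart, with [e_tau] moved to the origin. *)
Definition cone_of (X : {vspace 'rV[K]_n} -> Prop) B : Prop :=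
  tangent B /\ X (rowspan (centre + B)).

Lemma in_chartE X x :
  in_chart tau X (mxvec centre + x) <-> cone_of X (vec_mx x).
Proof.
rewrite /in_chart linearD /= mxvecK; split=> -[H1 H2]; split=> //.
  exact/chart_matrixE.
exact/chart_matrixE.
Qed.

(* The scaling is induced by the torus element that is [1] on the columns in  *)
(* [tau] and [c] elsewhere.                                                   *)
Lemma cone_of_scale Q c B : incident Q (e_pt K tau) ->
  cone_of (incident Q) B -> cone_of (incident Q) (c *: B).
Proof.
move=> Qtau [TB QB]; split=> [s t|]; first by rewrite mxE TB mulr0.
(* At [c = 0] the torus element degenerates, and the apex is covered by hypothesis. *)
have [->|c0] := eqVneq c 0; first by rewrite scale0r addr0 rowspan_centre.
pose r : 'rV[K]_n := \row_j if [exists t, tau t == j] then 1 else c.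
have -> : centre + c *: B = (centre + B) *m diag_mx r.
  apply/matrixP => s j; rewrite mul_mx_diag !mxE.
  case: ifP => [/existsP[t /eqP <-]|/negbT]; first by rewrite TB mulr0 mulr1.
  rewrite negb_exists => /forallP/(_ s); rewrite eq_sym => /negPf->.
  by rewrite !add0r mulrC.
apply: incident_mulmx QB => [|t x /coord_spaceP x0].
  rewrite unitmxE det_diag unitfE; apply/prodf_neq0 => j _; rewrite mxE.
  by case: ifP; rewrite ?oner_eq0.
by apply/coord_spaceP => j /x0 xj; rewrite mul_mx_diag mxE xj mul0r.
Qed.

(* [1 + centre^T *m C] is a unipotent element translating the chart by [C].   *)
Lemma cone_of_shift Q B C : tangent C ->
    (forall t s i, Q t (tau s) -> ~~ Q t i -> C s i = 0) ->
  cone_of (incident Q) B -> cone_of (incident Q) (B + C).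
Proof.
move=> TC QC [TB QB]; split=> [s t|]; first by rewrite mxE TB TC addr0.
pose M := centre^T *m C.
have CP := (tangentE C).1 TC; have BP := (tangentE B).1 TB.
have -> : centre + (B + C) = (centre + B) *m (1%:M + M).
  rewrite mulmxDr mulmx1 mulmxA mulmxDl centreK BP addr0 mul1mx.
  by rewrite addrA.
apply: incident_mulmx QB => [|t x /coord_spaceP x0].
  (* [C] kills the columns in [tau], so [M] squares to zero and [1 - M] inverts [1 + M]. *)
  have MM : M *m M = 0 by rewrite /M mulmxA -(mulmxA _ C) CP mulmx0 mul0mx.
  apply: (@mulmx1_unit _ _ _ (1%:M - M) _).1.
  by rewrite mulmxDl mul1mx mulmxBr mulmx1 MM subr0 subrK.
rewrite mulmxDr mulmx1 rpredD //; first exact/coord_spaceP.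
apply/coord_spaceP => i nQi; rewrite mulmxA mxE big1 // => s _.
rewrite mul_tr_centre; have [/QC->|/x0->] := boolP (Q t (tau s));
  by rewrite ?mulr0 ?mul0r.
Qed.

Lemma smooth_at_cone X : X (e_pt K tau) ->
    (forall c B, cone_of X B -> cone_of X (c *: B)) ->
  smooth_at d X (e_pt K tau) <->
  (forall B C, cone_of X B -> cone_of X C -> cone_of X (B + C)).
Proof.
move=> Xtau XZ.
have X0 : cone_of X 0.
  by split=> [s t|]; rewrite ?mxE // addr0 rowspan_centre.
rewrite smooth_at_e_pt cone_smooth_at.
- split=> [H B C XB XC|H x y /in_chartE Xx /in_chartE Xy]; last first.
    by apply/in_chartE; rewrite linearD; apply: H.
  have : in_chart tau X (mxvec centre + (mxvec B + mxvec C)).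
    by apply: H; apply/in_chartE; rewrite mxvecK.
  by move=> /in_chartE; rewrite -linearD mxvecK.
- by rewrite -[mxvec _]addr0; apply/in_chartE; rewrite linear0.
- by move=> c x /in_chartE Xx; apply/in_chartE; rewrite linearZ; apply: XZ.
Qed.

End Chart.

(** * Schubert and Richardson cones *)

Section Richardson.

Variables (K : closedFieldType) (d n : nat).
Implicit Types (w tau v : Idn d n).

Definition below w (t : 'I_d) : pred 'I_n := fun j => (j < (w t).+1)%N.

(** Left unsimplified to remain convertible to the condition in [opp_schubert]. *)
Definition above v (t : 'I_d) : pred 'I_n :=
  fun j => (n - (n - (v (rev_ord t)).+1 + 1) <= j)%N.

Lemma aboveE v t j : above v t j = (v (rev_ord t) <= j)%N.
Proof. by rewrite /above addn1 subnSK // subKn // ltnW. Qed.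

Lemma dim_e_pt tau : \dim (e_pt K tau) = d.
Proof.
apply/eqP; rewrite eqn_leq; apply/andP; split.
  apply: leq_trans (leq_of_leqif (dimv_sum_leqif _)) _.
  rewrite -[leqRHS]card_ord -sum1_card; apply: leq_sum => i _.
  by rewrite /= dim_vline leq_b1.
apply: (leq_dim_basis_vec (@Idn_inj _ _ tau)) => i.
by rewrite memvE (sumv_sup i).
Qed.

(** [h] orders the basis vectors of [e_tau] so that the first [t.+1] lie in the [t]-th flag space:
    the identity for [X_w], [rev_ord] for [X^v]. *)
Lemma incident_e_pt tau (Q : 'I_d -> pred 'I_n) (h : 'I_d -> 'I_d) :
    injective h -> (forall t s : 'I_d, (s <= t)%N -> Q t (tau (h s))) ->
  incident Q (e_pt K tau).
Proof.
move=> h_inj Qh; split=> [|t]; first exact: dim_e_pt.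
have lift_inj : injective (widen_ord (ltn_ord t)).
  by move=> i j /(congr1 val) /= /val_inj.
apply: (leq_dim_basis_vec
  (inj_comp (@Idn_inj _ _ tau) (inj_comp h_inj lift_inj))).
move=> i; rewrite memv_cap mem_basis_vec Qh; last exact: (ltn_ord i).
rewrite andbT.
by rewrite memvE (sumv_sup (h (widen_ord (ltn_ord t) i))).
Qed.

Lemma schubert_e_pt w tau : Idn_ge w tau -> incident (below w) (e_pt K tau).
Proof.
move=> le_tw; apply: (@incident_e_pt _ _ id) => // t s st.
by rewrite /below ltnS (leq_trans _ (le_tw t)) // Idn_leq.
Qed.

Lemma opp_schubert_e_pt v tau : Idn_ge tau v -> incident (above v) (e_pt K tau).
Proof.
move=> le_vt; apply: (incident_e_pt rev_ord_inj) => t s st.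
by rewrite aboveE (leq_trans (le_vt _)) // Idn_leq leq_sub2l.
Qed.

Definition lower_part tau (B : 'M[K]_(d, n)) : 'M[K]_(d, n) :=
  \matrix_(s, j) if (j < tau s)%N then B s j else 0.

Definition upper_part tau (B : 'M[K]_(d, n)) : 'M[K]_(d, n) :=
  \matrix_(s, j) if (tau s < j)%N then B s j else 0.

Lemma lower_upper tau B :
  tangent tau B -> lower_part tau B + upper_part tau B = B.
Proof.
move=> TB; apply/matrixP => s j; rewrite !mxE.
by case: ltngtP => [||/val_inj->]; rewrite ?addr0 ?add0r ?TB.
Qed.

Lemma lower_upper0 tau B : lower_part tau (upper_part tau B) = 0.
Proof. by apply/matrixP => s j; rewrite !mxE; case: ltngtP. Qed.

Lemma upper_lower0 tau B : upper_part tau (lower_part tau B) = 0.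
Proof. by apply/matrixP => s j; rewrite !mxE; case: ltngtP. Qed.

Lemma lower_partD tau B C :
  lower_part tau (B + C) = lower_part tau B + lower_part tau C.
Proof. by apply/matrixP => s j; rewrite !mxE; case: ifP; rewrite ?addr0. Qed.

Lemma upper_partD tau B C :
  upper_part tau (B + C) = upper_part tau B + upper_part tau C.
Proof. by apply/matrixP => s j; rewrite !mxE; case: ifP; rewrite ?addr0. Qed.

Lemma tangent_lower tau B : tangent tau B -> tangent tau (lower_part tau B).
Proof. by move=> TB s t; rewrite mxE TB if_same. Qed.

Lemma tangent_upper tau B : tangent tau B -> tangent tau (upper_part tau B).
Proof. by move=> TB s t; rewrite mxE TB if_same. Qed.

Lemma tangentN tau (B : 'M[K]_(d, n)) : tangent tau B -> tangent tau (- B).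
Proof. by move=> TB s t; rewrite mxE TB oppr0. Qed.

(** A lower entry moves column [tau s] towards smaller indices, which stays inside every [flag]; so
    adding or removing the lower part is a [cone_of_shift]. *)
Lemma cone_schubertE w tau B : tangent tau B ->
  cone_of tau (schubert K w) B <->
  cone_of tau (schubert K w) (upper_part tau B).
Proof.
move=> TB; have TL := tangent_lower TB.
have shift C c : tangent tau C ->
    (forall s (j : 'I_n), (tau s <= j)%N -> C s j = 0) ->
    cone_of tau (schubert K w) c -> cone_of tau (schubert K w) (c + C).
  move=> TC C0; apply: (@cone_of_shift _ _ _ _ (below w)) => // t s j.
  rewrite /below ltnS => ts; rewrite -leqNgt => tj.
  by rewrite C0 // (leq_trans ts) // ltnW.
have L0 s (j : 'I_n) : (tau s <= j)%N -> lower_part tau B s j = 0.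
  by move=> sj; rewrite mxE ltnNge sj.
split=> [wB|/(shift (lower_part tau B))]; last first.
  by rewrite addrC lower_upper //; apply.
have -> : upper_part tau B = B - lower_part tau B.
  by rewrite -[X in X - _](lower_upper TB) addrC addKr.
apply: shift wB; first exact: tangentN.
by move=> s j /L0 Lsj; rewrite mxE Lsj oppr0.
Qed.

Lemma cone_opp_schubertE v tau B : tangent tau B ->
  cone_of tau (opp_schubert K v) B <->
  cone_of tau (opp_schubert K v) (lower_part tau B).
Proof.
move=> TB; have TL := tangent_upper TB.
have shift C c : tangent tau C ->
    (forall s (j : 'I_n), (j <= tau s)%N -> C s j = 0) ->
    cone_of tau (opp_schubert K v) c -> cone_of tau (opp_schubert K v) (c + C).
  move=> TC C0; apply: (@cone_of_shift _ _ _ _ (above v)) => // t s j.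
  rewrite !aboveE => ts; rewrite -ltnNge => tj.
  by rewrite C0 // (leq_trans _ ts) // ltnW.
have L0 s (j : 'I_n) : (j <= tau s)%N -> upper_part tau B s j = 0.
  by move=> sj; rewrite mxE ltnNge sj.
split=> [vB|/(shift (upper_part tau B))]; last first.
  by rewrite lower_upper //; apply.
have -> : lower_part tau B = B - upper_part tau B.
  by rewrite -[X in X - _](lower_upper TB) addrK.
apply: shift vB; first exact: tangentN.
by move=> s j /L0 Usj; rewrite mxE Usj oppr0.
Qed.

End Richardson.

Theorem corollary7p6p5 (K : closedFieldType) (d n : nat)
    (hd : (1 <= d)%N) (hdn : (d < n)%N) (w tau v : Idn d n)
    (hwtau : Idn_ge w tau) (htauv : Idn_ge tau v) :
  smooth_at d (richardson K w v) (e_pt K tau) <->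
  smooth_at d (schubert K w) (e_pt K tau) /\
  smooth_at d (opp_schubert K v) (e_pt K tau).
Proof.
have Qw := schubert_e_pt K hwtau; have Qv := opp_schubert_e_pt K htauv.
have RE B : cone_of tau (richardson K w v) B <->
    cone_of tau (schubert K w) B /\ cone_of tau (opp_schubert K v) B.
  by split=> [[TB [? ?]]|[[TB ?] [_ ?]]].
have wZ c B : cone_of tau (schubert K w) B ->
    cone_of tau (schubert K w) (c *: B).
  exact: cone_of_scale.
have vZ c B : cone_of tau (opp_schubert K v) B ->
    cone_of tau (opp_schubert K v) (c *: B).
  exact: cone_of_scale.
rewrite !smooth_at_cone //; last by move=> c B /RE[/wZ XB /vZ YB]; apply/RE.
split=> [RD|[wD vD] B C /RE[wB vB] /RE[wC vC]]; last first.
  by apply/RE; split; [apply: wD | apply: vD].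
have w0 : cone_of tau (schubert K w) 0.
  by split=> [s t|]; rewrite ?mxE // addr0 rowspan_centre.
have v0 : cone_of tau (opp_schubert K v) 0.
  by split=> [s t|]; rewrite ?mxE // addr0 rowspan_centre.
split=> B C XB XC; have [TB _] := XB; have [TC _] := XC.
  have TBC : tangent tau (B + C) by move=> s t; rewrite mxE TB TC addr0.
  (* The upper part of a point of [X_w] also lies in [X^v], because its own lower part is the
     apex. *)
  have toR D : cone_of tau (schubert K w) D ->
      cone_of tau (richardson K w v) (upper_part tau D).
    move=> XD; have TD := XD.1; apply/RE; split;
      first exact: (cone_schubertE _ TD).1 XD.
    by apply/(cone_opp_schubertE _ (tangent_upper TD)); rewrite lower_upper0.
  apply/(cone_schubertE _ TBC); rewrite upper_partD.
  by have /RE[] := RD _ _ (toR _ XB) (toR _ XC).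
have TBC : tangent tau (B + C) by move=> s t; rewrite mxE TB TC addr0.
have toR D : cone_of tau (opp_schubert K v) D ->
    cone_of tau (richardson K w v) (lower_part tau D).
  move=> XD; have TD := XD.1; apply/RE; split;
    last exact: (cone_opp_schubertE _ TD).1 XD.
  by apply/(cone_schubertE _ (tangent_lower TD)); rewrite upper_lower0.
apply/(cone_opp_schubertE _ TBC); rewrite lower_partD.
by have /RE[] := RD _ _ (toR _ XB) (toR _ XC).
Qed.
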